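(* Let $p,q\geqslant 1$ be real numbers and let $d$ be a positive integer. For all $\mathbf{x},\mathbf{y}\in\mathbb{R}^d$, $$W_{q,p}(\delta_{\mathbf{x}},\delta_{\mathbf{y}})=\|\mathbf{x}-\mathbf{y}\|_p.$$
   Context: For real $p,q\geqslant1$, $\|\cdot\|_p$ denotes the $\ell_p$ norm on $\mathbb{R}^d$, and $\mathcal{P}_{q,p}(\mathbb{R}^d)$ is the set of (Borel) probability measures on $\mathbb{R}^d$ with finite moment of order $q$ with respect to $\|\cdot\|_p$, i.e. $\int\|\mathbf{u}\|_p^q\,d\mu(\mathbf{u})<\infty$. For $\mu,\nu\in\mathcal{P}_{q,p}(\mathbb{R}^d)$, $\Pi(\mu,\nu)$ is the set of all probability measures on $\mathbb{R}^d\times\mathbb{R}^d$ with first marginal $\mu$ and second marginal $\nu$. The Wasserstein distance is $$W_{q,p}(\mu,\nu)=\left(\inf_{\pi\in\Pi(\mu,\nu)}\int\|\mathbf{u}-\mathbf{v}\|_p^q\,d\pi(\mathbf{u},\mathbf{v})\right)^{1/q}.$$ For $\mathbf{x}\in\mathbb{R}^d$, $\delta_{\mathbf{x}}$ is the probability measure giving mass one to the point $\mathbf{x}$ (Dirac measure). *)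

(* Defs.v *)
From HB Require Import structures.
From mathcomp Require Import all_boot all_order all_algebra.
From mathcomp Require Import all_classical all_reals all_analysis.
From mathcomp Require Import measurable_realfun.
Import Order.TTheory GRing.Theory Num.Theory.
Import numFieldNormedType.Exports.

Set Implicit Arguments.
Unset Strict Implicit.
Unset Printing Implicit Defensive.

Local Open Scope classical_set_scope.
Local Open Scope ring_scope.

(* R^d with its Borel sigma-algebra. As a type this is convertible to 'rV[R]_d,
   whose topology is the usual one (it is induced by the sup norm). *)
Notation borel_rV R d := (g_sigma_algebraType (@open 'rV[R]_d)).

Definition lpnorm (R : realType) (d : nat) (p : R) (u : 'rV[R]_d) : R :=
  (\sum_(i < d) `|u ord0 i| `^ p) `^ p^-1.

Record Pqp (R : realType) (d : nat) (q p : R) := MkPqp {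
  Pqp_measure :> probability (borel_rV R d) R;
  Pqp_moment : (\int[Pqp_measure]_u (lpnorm p u `^ q)%:E < +oo)%E }.

(* The marginals are only compared on measurable sets: a measure is a function
   on all sets, whose values outside the sigma-algebra are irrelevant. The
   product carries the product sigma-algebra, which is the Borel one because
   R^d is second countable. *)
Definition coupling (R : realType) (d : nat) (mu nu : probability (borel_rV R d) R)
    : set (probability (borel_rV R d * borel_rV R d)%type R) :=
  [set pi | (forall A, measurable A -> pushforward pi fst A = mu A) /\
            (forall B, measurable B -> pushforward pi snd B = nu B)].

(* The infimum and the root are taken in the extended reals, so that no
   convention for infinite costs is needed. *)
Definition wasserstein (R : realType) (d : nat) (q p : R) (mu nu : Pqp d q p)
    : \bar R :=
  (ereal_inf [set \int[pi]_uv
                    (lpnorm p ((uv.1 : 'rV[R]_d) - (uv.2 : 'rV[R]_d)) `^ q)%:E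
             | pi in coupling mu nu] `^ q^-1)%E.
Arguments wasserstein {R d} q p mu nu.

Lemma measurable_coord (R : realType) (d : nat) (i : 'I_d) :
  measurable_fun [set: borel_rV R d] (fun u : borel_rV R d => (u : 'rV[R]_d) ord0 i).
Proof.
apply: (measurability (@RGenOpens.G R)).
  exact: RGenOpens.measurableE.
move=> _ [_ [a [b ->]] <-]; rewrite setTI; apply: sub_sigma_algebra.
apply: open_comp; last exact: interval_open.
by move=> u _; exact: coord_continuous.
Qed.

Lemma measurable_lpnorm (R : realType) (d : nat) (p : R) :
  measurable_fun [set: borel_rV R d] (fun u : borel_rV R d => lpnorm p u).
Proof.
apply: (measurableT_comp (measurable_powR _)).
apply: measurable_sum => i.
apply: (measurableT_comp (measurable_powR _)).
by apply: measurableT_comp => //; exact: measurable_coord.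
Qed.

Lemma dirac_moment (R : realType) (d : nat) (q p : R) (x : borel_rV R d) :
  (\int[dirac x]_u (lpnorm p u `^ q)%:E < +oo :> \bar R)%E.
Proof.
rewrite integral_dirac//; first by rewrite diracT mul1e ltry.
apply/measurable_EFinP; apply: (measurableT_comp (measurable_powR _)).
exact: measurable_lpnorm.
Qed.

Definition dirac_Pqp (R : realType) (d : nat) (q p : R) (x : 'rV[R]_d) : Pqp d q p :=
  @MkPqp R d q p (dirac (x : borel_rV R d)) (dirac_moment q p x).

(* Main.v *)
(* Singletons are Borel, so every coupling of two Dirac masses is concentrated at
   the single pair (x, y): all couplings have the same cost. *)
Require Import Defs.
From mathcomp Require Import all_boot all_order all_algebra.
From mathcomp Require Import all_classical all_reals all_analysis.
From mathcomp Require Import measurable_realfun.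
Import Order.TTheory GRing.Theory Num.Theory.
Import numFieldNormedType.Exports.

Set Implicit Arguments.
Unset Strict Implicit.
Unset Printing Implicit Defensive.

Local Open Scope classical_set_scope.
Local Open Scope ring_scope.

(** The first marginal of a coupling puts no mass off $x$ and the second none off $y$, so the
    coupling lives on the single pair $(x,y)$ ([coupling_dirac_ae]). Its cost integrand is thus
    almost everywhere the constant $\|x-y\|_p^q$, and total mass one makes this the cost. As a
    coupling exists ([coupling_dirac_pair]), the infimum is this value, and its $q$-th root is the
    norm. *)

Lemma measurable_rV_set1 (R : realType) (d : nat) (x : 'rV[R]_d) :
  measurable ([set x] : set (borel_rV R d)).
Proof.
rewrite -[X in measurable X]setCK; apply: measurableC.
apply: sub_sigma_algebra; apply: closed_openC.
exact/accessible_closed_set1/hausdorff_accessible/norm_hausdorff.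
Qed.

(** Argued coordinate by coordinate through the projections, which suits the product sigma-algebra
    directly. *)
Lemma measurable_lpdist (R : realType) (d : nat) (p : R) :
  measurable_fun [set: borel_rV R d * borel_rV R d]
    (fun uv => lpnorm p ((uv.1 : 'rV[R]_d) - (uv.2 : 'rV[R]_d))).
Proof.
apply: (measurableT_comp (measurable_powR _)).
apply: measurable_sum => i.
apply: (measurableT_comp (measurable_powR _)).
apply: measurableT_comp => //.
under eq_fun do rewrite !mxE.
apply: measurable_funB.
  exact: measurableT_comp (@measurable_coord R d i) measurable_fst.
exact: measurableT_comp (@measurable_coord R d i) measurable_snd.
Qed.

Lemma measurable_lpcost (R : realType) (d : nat) (q p : R) :
  measurable_fun [set: borel_rV R d * borel_rV R d]
    (fun uv => (lpnorm p ((uv.1 : 'rV[R]_d) - (uv.2 : 'rV[R]_d)) `^ q)%:E).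
Proof.
apply/measurable_EFinP; apply: (measurableT_comp (measurable_powR _)).
exact: measurable_lpdist.
Qed.

Lemma coupling_dirac_ae (R : realType) (d : nat) (q p : R) (x y : 'rV[R]_d)
    (pi : probability (borel_rV R d * borel_rV R d)%type R) :
  coupling (dirac_Pqp q p x) (dirac_Pqp q p y) pi ->
  {ae pi, forall uv, uv = (x, y)}.
Proof.
move=> [pi1 pi2].
have mC (z : 'rV[R]_d) : measurable (~` [set z] : set (borel_rV R d)).
  by apply: measurableC; exact: measurable_rV_set1.
have ae1 : {ae pi, forall uv, uv.1 = x}.
  exists (fst @^-1` (~` [set x])); split => //.
    by rewrite -[X in measurable X]setTI; exact: measurable_fst.
  (* The mass of this preimage is the first marginal of the complement of $x$, which $\delta_x$
     sends to 0. *)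
  by have := pi1 _ (mC x); rewrite /pushforward /= diracE memNset//=; apply.
have ae2 : {ae pi, forall uv, uv.2 = y}.
  exists (snd @^-1` (~` [set y])); split => //.
    by rewrite -[X in measurable X]setTI; exact: measurable_snd.
  by have := pi2 _ (mC y); rewrite /pushforward /= diracE memNset//=; apply.
have aeF := ae_filter_ringOfSetsType pi.
by apply: filterS2 ae1 ae2 => -[u v] /= -> ->.
Qed.

(** Ensures that the infimum is not over the empty set, where it would be $+\infty$. Both marginals
    hold by computation. *)
Lemma coupling_dirac_pair (R : realType) (d : nat) (q p : R) (x y : 'rV[R]_d) :
  coupling (dirac_Pqp q p x) (dirac_Pqp q p y)
    (dirac ((x, y) : borel_rV R d * borel_rV R d)).
Proof. by split. Qed.

Theorem lemma1 (R : realType) (p q : R) (hp : 1 <= p) (hq : 1 <= q)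
  (d : nat) (hd : (0 < d)%N) (x y : 'rV[R]_d) :
  wasserstein q p (dirac_Pqp q p x) (dirac_Pqp q p y) = (lpnorm p (x - y))%:E.
Proof.
have cost pi : coupling (dirac_Pqp q p x) (dirac_Pqp q p y) pi ->
    (\int[pi]_uv (lpnorm p ((uv.1 : 'rV[R]_d) - (uv.2 : 'rV[R]_d)) `^ q)%:E =
     (lpnorm p (x - y) `^ q)%:E)%E.
  move=> /coupling_dirac_ae pixy.
  rewrite (ae_eq_integral (cst (lpnorm p (x - y) `^ q)%:E))//.
  - by rewrite integral_cst// [X in (_ * X)%E](probability_setT pi) mule1.
  - exact: (@measurable_lpcost R d q p).
  - have aeF := ae_filter_ringOfSetsType pi.
    by apply: filterS pixy => _ -> _.
rewrite /wasserstein.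
rewrite [X in ereal_inf X](_ : _ = [set (lpnorm p (x - y) `^ q)%:E]); last first.
  apply/seteqP; split => [_ [pi /cost + <-]//|_ ->].
  have xy := coupling_dirac_pair q p x y.
  by eexists; [exact: xy | exact: cost].
(* $(a^q)^{1/q}=a$ needs $a\geqslant 0$, true since [lpnorm] is itself a [powR], and $q\neq 0$, from
   [hq]. *)
rewrite ereal_inf1 poweR_EFin -powRrM mulfV ?powRr1 ?powR_ge0//.
by rewrite gt_eqF// (lt_le_trans ltr01).
Qed.
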